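(* Let $X$ be a Peano continuum and let $f:X\to X$ be a cw-expansive homeomorphism. Then for every $\varepsilon>0$ there exists $\delta>0$ such that $$\inf_{x\in X}\operatorname{diam} CW^s_\varepsilon(x)\ \ge\ \delta\qquad\text{and}\qquad \inf_{x\in X}\operatorname{diam} CW^u_\varepsilon(x)\ \ge\ \delta .$$
   Context: A Peano continuum is a compact, connected, locally connected metric space $(X,d)$ with more than one point. A homeomorphism $f:X\to X$ of a compact metric space is continuum-wise expansive (cw-expansive) if there is a constant $\alpha>0$ such that $\sup_{n\in\mathbb Z}\operatorname{diam} f^n(C)>\alpha$ for every continuum $C\subset X$ containing more than one point. For $\varepsilon>0$ and $x\in X$: $W^s_\varepsilon(x)=\{y\in X:\ d(f^n(x),f^n(y))\le\varepsilon \text{ for all } n\ge 0\}$, $W^u_\varepsilon(x)=\{y\in X:\ d(f^{-n}(x),f^{-n}(y))\le\varepsilon \text{ for all } n\ge 0\}$, and $CW^\sigma_\varepsilon(x)$ ($\sigma=s,u$) denotes the connected component of $W^\sigma_\varepsilon(x)$ containing $x$. *)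

(* Defs.v *)
From Stdlib Require Import Reals ZArith List.
From Coquelicot Require Import Coquelicot.
Open Scope R_scope.

Record is_metric (T : Type) (d : T -> T -> R) : Prop := {
  dist_nonneg : forall x y, 0 <= d x y;
  dist_eq0 : forall x y, d x y = 0 <-> x = y;
  dist_sym : forall x y, d x y = d y x;
  dist_tri : forall x y z, d x z <= d x y + d y z }.

Section MetricNotions.
Context {T : Type} (d : T -> T -> R).

Definition mopen (U : T -> Prop) : Prop :=
  forall x, U x -> exists r, 0 < r /\ forall y, d x y < r -> U y.

Definition compact_space : Prop :=
  forall (I : Type) (U : I -> T -> Prop),
    (forall i, mopen (U i)) -> (forall x, exists i, U i x) ->
    exists l : list I, forall x, exists i, In i l /\ U i x.

Definition mconnected (A : T -> Prop) : Prop :=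
  forall U V : T -> Prop, mopen U -> mopen V ->
    (forall x, A x -> U x \/ V x) ->
    (forall x, A x -> U x -> V x -> False) ->
    (forall x, A x -> U x) \/ (forall x, A x -> V x).

Definition locally_connected_space : Prop :=
  forall x U, mopen U -> U x ->
    exists V, mopen V /\ V x /\ mconnected V /\ (forall y, V y -> U y).

Definition peano_continuum : Prop :=
  is_metric T d /\ compact_space /\ mconnected (fun _ => True) /\
  locally_connected_space /\ exists x y : T, x <> y.

Definition mcompact (A : T -> Prop) : Prop :=
  forall (I : Type) (U : I -> T -> Prop),
    (forall i, mopen (U i)) -> (forall x, A x -> exists i, U i x) ->
    exists l : list I, forall x, A x -> exists i, In i l /\ U i x.

Definition continuum (C : T -> Prop) : Prop :=
  mcompact C /\ mconnected C /\ exists x, C x.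

Definition diam (A : T -> Prop) : Rbar :=
  Lub_Rbar (fun r => exists x y, A x /\ A y /\ r = d x y).

Definition mcontinuous (f : T -> T) : Prop :=
  forall x eps, 0 < eps -> exists del, 0 < del /\
    forall y, d x y < del -> d (f x) (f y) < eps.

Definition homeomorphism (f g : T -> T) : Prop :=
  mcontinuous f /\ mcontinuous g /\
  (forall x, g (f x) = x) /\ (forall x, f (g x) = x).

Definition iterZ (f g : T -> T) (n : Z) (x : T) : T :=
  match n with
  | Z0 => x
  | Zpos p => Nat.iter (Pos.to_nat p) f x
  | Zneg p => Nat.iter (Pos.to_nat p) g x
  end.

Definition image (h : T -> T) (A : T -> Prop) : T -> Prop :=
  fun y => exists x, A x /\ y = h x.

(* cw-expansive: exists alpha > 0 such that for every continuum C with more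
   than one point, sup_{n in Z} diam f^n(C) > alpha, i.e. some
   diam f^n(C) exceeds alpha *)
Definition cw_expansive (f g : T -> T) : Prop :=
  exists alpha, 0 < alpha /\
    forall C, continuum C -> (exists x y, C x /\ C y /\ x <> y) ->
      exists n : Z, Rbar_lt (Finite alpha) (diam (image (iterZ f g n) C)).

Definition Ws (f : T -> T) (eps : R) (x : T) : T -> Prop :=
  fun y => forall n : nat, d (Nat.iter n f x) (Nat.iter n f y) <= eps.
Definition Wu (g : T -> T) (eps : R) (x : T) : T -> Prop :=
  fun y => forall n : nat, d (Nat.iter n g x) (Nat.iter n g y) <= eps.

Definition component (A : T -> Prop) (x : T) : T -> Prop :=
  fun y => exists B, mconnected B /\ B x /\ B y /\ (forall z, B z -> A z).

Definition CWs (f : T -> T) (eps : R) (x : T) := component (Ws f eps x) x.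
Definition CWu (g : T -> T) (eps : R) (x : T) := component (Wu g eps x) x.

Definition inf_diam_ge (S : T -> T -> Prop) (del : R) : Prop :=
  forall x, Rbar_le (Finite del) (diam (S x)).
End MetricNotions.

(* Main.v *)
(* Fine chains replace the hyperspace of subcontinua: in a closed set two points lie in
   a common connected subset iff they are joined by chains of every mesh. This yields
   boundary bumping and stability of connectedness under decreasing intersections, and
   hence, from cw-expansivity, a uniform contraction of continua all of whose forward
   iterates stay small, and Kato's lemma that a continuum small at times 0 and n is small
   at all times in between.

   There are no stable points: if all forward iterates of a ball around u stay small,
   then by Kato's lemma and bumping the points f^-n(z), for z near u, have neighbourhoods
   of uniform size contracting under f. By pigeonhole two of f^-n(z), ..., f^-(n+m)(z),
   with m independent of n, share such a neighbourhood; applying f^n shows that z is a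
   limit of, hence equal to, some f^-j(z) with 1 <= j <= m. So all points near u are
   periodic, while the distance between nearby ones tends to 0 under f, although u is
   not isolated.

   By compactness the instability is uniform. Given x, a tiny continuum at f^-n(x), with
   n large, therefore grows beyond size eps before time n; bumping cuts it down to a
   continuum whose maximal size up to time n is about eps. By Kato's lemma its image at x still has diameter at least del, with
   del independent of n, and its backward iterates stay eps-small up to time n.
   Let n tend to infinity. The stable case follows by exchanging f and f^-1. *)

From Stdlib Require Import Reals Lra Lia List Classical ClassicalEpsilon.
From Coquelicot Require Import Coquelicot.
Require Import Defs.
Open Scope R_scope.

(** * Choice, iterates and finite combinatorics *)

Lemma seq_choice {A : Type} (P : nat -> A -> Prop) :
  (forall n, exists a, P n a) -> exists u : nat -> A, forall n, P n (u n).
Proof.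
  intros H.
  exists (fun n => proj1_sig (constructive_indefinite_description _ (H n))).
  intros n. apply proj2_sig.
Qed.

Lemma inv_succ_pos (n : nat) : 0 < / (INR n + 1).
Proof. apply Rinv_0_lt_compat. pose proof (pos_INR n). lra. Qed.

Lemma inv_succ_small (e : R) : 0 < e ->
  exists N, forall n, (N <= n)%nat -> / (INR n + 1) < e.
Proof.
  intros He. destruct (archimed_cor1 e He) as [N [HN HN0]].
  exists N. intros n Hn. apply Rlt_trans with (/ INR N); [|exact HN].
  apply lt_INR in HN0. simpl in HN0. apply le_INR in Hn.
  apply Rinv_lt_contravar; nra.
Qed.

Lemma iter_iter {A : Type} (f : A -> A) (i j : nat) (x : A) :
  Nat.iter i f (Nat.iter j f x) = Nat.iter (i + j) f x.
Proof. induction i as [|i IH]; simpl; congruence. Qed.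

Lemma iter_cancel {A : Type} (f g : A -> A) (n : nat) (x : A) :
  (forall y, f (g y) = y) -> Nat.iter n f (Nat.iter n g x) = x.
Proof.
  intros H. revert x. induction n as [|n IH]; intros x; [reflexivity|].
  rewrite (Nat.iter_succ_r n _ f). simpl. rewrite H. apply IH.
Qed.

Lemma iter_sub {A : Type} (f g : A -> A) (i n : nat) (x : A) :
  (forall y, f (g y) = y) -> (i <= n)%nat ->
  Nat.iter i f (Nat.iter n g x) = Nat.iter (n - i) g x.
Proof.
  intros H Hi. pose proof (iter_iter g i (n - i) x) as E.
  replace (i + (n - i))%nat with n in E by lia.
  rewrite <- E. apply iter_cancel, H.
Qed.

Lemma iter_fixed_mul {A : Type} (f : A -> A) (j k : nat) (x : A) :
  Nat.iter j f x = x -> Nat.iter (k * j) f x = x.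
Proof.
  intros H. induction k as [|k IH]; [reflexivity|].
  simpl. rewrite <- iter_iter. congruence.
Qed.

(** The length of the window after [n] does not depend on [n]. A lower bound over all possible
    differences [b - a] can therefore be fixed before [n] is chosen. *)
Lemma pigeonhole_nat {A : Type} (l : list A) (c : nat -> A) :
  (forall n, In (c n) l) ->
  forall n, exists a b, (n <= a < b)%nat /\ (b <= n + length l)%nat /\ c a = c b.
Proof.
  intros Hc n. apply NNPP. intros H.
  assert (ND : NoDup (map c (seq n (S (length l))))).
  { apply NoDup_map_NoDup_ForallPairs; [|apply seq_NoDup].
    intros a b Ha Hb Hab. apply in_seq in Ha, Hb.
    destruct (Nat.lt_trichotomy a b) as [L|[L|L]]; [|exact L|]; exfalso; apply H.
    - exists a, b. repeat split; [lia..|exact Hab].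
    - exists b, a. repeat split; [lia..|now symmetry]. }
  apply NoDup_incl_length with (l' := l) in ND.
  - rewrite length_map, length_seq in ND. lia.
  - intros y Hy. apply in_map_iff in Hy. destruct Hy as [k [<- _]]. apply Hc.
Qed.

Lemma finite_lower_bound (F : nat -> R) (m : nat) :
  (forall j, (1 <= j <= m)%nat -> 0 < F j) ->
  exists r, 0 < r /\ forall j, (1 <= j <= m)%nat -> r <= F j.
Proof.
  induction m as [|m IH]; intros H; [exists 1; split; [lra|lia]|].
  destruct IH as [r [Hr IH]]; [intros j Hj; apply H; lia|].
  exists (Rmin r (F (S m))). split; [apply Rmin_glb_lt; [exact Hr|apply H; lia]|].
  intros j Hj. pose proof (Rmin_l r (F (S m))). pose proof (Rmin_r r (F (S m))).
  destruct (Nat.eq_dec j (S m)) as [->|]; [lra|].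
  apply Rle_trans with r; [lra|apply IH; lia].
Qed.

Definition mclosed {T : Type} (d : T -> T -> R) (A : T -> Prop) : Prop :=
  forall x, (forall r, 0 < r -> exists y, A y /\ d x y < r) -> A x.

Inductive chain {T : Type} (d : T -> T -> R) (A : T -> Prop) (e : R) (x : T) :
  T -> Prop :=
| chain_start : A x -> chain d A e x x
| chain_step y z : chain d A e x y -> A z -> d y z < e -> chain d A e x z.

(** For closed [A] in a compact space, [chained d A x] is the component of [x] in [A]; see
    [chain_of_component] and [component_of_chained]. *)
Definition chained {T : Type} (d : T -> T -> R) (A : T -> Prop) (x y : T) : Prop :=
  forall e, 0 < e -> chain d A e x y.

(** * Connected sets and chains *)

Section Metric.
Context {T : Type} {d : T -> T -> R} (Hd : is_metric T d).

Lemma dist_refl x : d x x = 0.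
Proof. now apply (dist_eq0 _ _ Hd). Qed.

Lemma mopen_ball c r : mopen d (fun y => d c y < r).
Proof.
  intros x Hx. exists (r - d c x). split; [lra|]. intros y Hy.
  pose proof (dist_tri _ _ Hd c x y). lra.
Qed.

Lemma mopen_preimage h U : mcontinuous d h -> mopen d U ->
  mopen d (fun x => U (h x)).
Proof.
  intros Hh HU x Hx. destruct (HU _ Hx) as [r [Hr HrU]].
  destruct (Hh x r Hr) as [s [Hs Hsr]]. exists s. split; auto.
Qed.

Lemma mopen_forall_le (U : nat -> T -> Prop) n : (forall i, mopen d (U i)) ->
  mopen d (fun x => forall i, (i <= n)%nat -> U i x).
Proof.
  intros HU x. induction n as [|n IH]; intros Hx.
  - destruct (HU 0%nat x (Hx _ (le_n _))) as [r [Hr H]]. exists r.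
    split; [exact Hr|]. intros y Hy i Hi. replace i with 0%nat by lia. auto.
  - destruct IH as [r [Hr H]]; [intros i Hi; apply Hx; lia|].
    destruct (HU (S n) x (Hx _ (le_n _))) as [s [Hs H']].
    exists (Rmin r s). split; [now apply Rmin_glb_lt|]. intros y Hy i Hi.
    pose proof (Rmin_l r s). pose proof (Rmin_r r s).
    destruct (Nat.eq_dec i (S n)) as [->|]; [apply H'; lra|].
    apply H; [lra|lia].
Qed.

Lemma mopen_compl A : mclosed d A -> mopen d (fun x => ~ A x).
Proof.
  intros HA x Hx. apply NNPP. intros H. apply Hx, HA. intros r Hr.
  apply NNPP. intros H'. apply H. exists r. split; [exact Hr|].
  intros y Hy Ay. apply H'. now exists y.
Qed.

Lemma mclosed_and A B : mclosed d A -> mclosed d B ->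
  mclosed d (fun x => A x /\ B x).
Proof.
  intros HA HB x H. split; [apply HA|apply HB]; intros r Hr;
    destruct (H r Hr) as [y [[? ?] ?]]; now exists y.
Qed.

Lemma mclosed_forall {I : Type} (A : I -> T -> Prop) :
  (forall i, mclosed d (A i)) -> mclosed d (fun x => forall i, A i x).
Proof.
  intros HA x H i. apply HA. intros r Hr.
  destruct (H r Hr) as [y [? ?]]. exists y. auto.
Qed.

Lemma mclosed_imp (P : Prop) A : mclosed d A -> mclosed d (fun x => P -> A x).
Proof.
  intros HA x H p. apply HA. intros r Hr.
  destruct (H r Hr) as [y [? ?]]. exists y. auto.
Qed.

Lemma mclosed_preimage_ball h c r : mcontinuous d h ->
  mclosed d (fun x => d c (h x) <= r).
Proof.
  intros Hh x H. apply Rnot_lt_le. intros L.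
  destruct (Hh x (d c (h x) - r)) as [s [Hs Hsr]]; [lra|].
  destruct (H s Hs) as [y [Hy Hxy]]. specialize (Hsr y Hxy).
  pose proof (dist_tri _ _ Hd c (h y) (h x)).
  rewrite (dist_sym _ _ Hd (h y)) in H0. lra.
Qed.

Lemma mcontinuous_id : mcontinuous d (fun x => x).
Proof. intros x e He. exists e. auto. Qed.

Lemma mcontinuous_iter f n : mcontinuous d f -> mcontinuous d (Nat.iter n f).
Proof.
  intros Hf. induction n as [|n IH]; simpl; [apply mcontinuous_id|].
  intros x e He. destruct (Hf (Nat.iter n f x) e He) as [s [Hs H]].
  destruct (IH x s Hs) as [t [Ht H']]. exists t. split; [exact Ht|].
  intros y L. apply H, H', L.
Qed.

Lemma mclosed_ball c r : mclosed d (fun x => d c x <= r).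
Proof. apply (mclosed_preimage_ball (fun x => x)), mcontinuous_id. Qed.

Lemma component_refl (A : T -> Prop) x : A x -> component d A x x.
Proof.
  intros Ax. exists (fun z => z = x). repeat split; [|intros z ->; exact Ax].
  intros U V _ _ H _.
  destruct (H x eq_refl); [left|right]; intros z ->; assumption.
Qed.

Lemma component_left (A : T -> Prop) x y : component d A x y -> A x.
Proof. intros [B [_ [Bx [_ H]]]]. auto. Qed.

Lemma component_right (A : T -> Prop) x y : component d A x y -> A y.
Proof. intros [B [_ [_ [By H]]]]. auto. Qed.

(** The connected witness lies inside the component, so only points of the component have to be
    checked. Estimates that rely on the connection to [x] thus upgrade from points to components. *)
Lemma component_sub (A A' : T -> Prop) x y : component d A x y ->
  (forall z, component d A x z -> A' z) -> component d A' x y.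
Proof.
  intros [B [HB [Bx [By H]]]] H'. exists B. repeat split; auto.
  intros z Bz. apply H'. exists B. auto.
Qed.

Lemma component_image h (A A' : T -> Prop) x y : mcontinuous d h ->
  component d A x y -> (forall z, A z -> A' (h z)) ->
  component d A' (h x) (h y).
Proof.
  intros Hh [B [HB [Bx [By H]]]] H'. exists (image h B).
  repeat split; [|now exists x|now exists y|].
  - intros U V HU HV Hc Hdis.
    destruct (HB (fun z => U (h z)) (fun z => V (h z))) as [Hl|Hr].
    + now apply mopen_preimage.
    + now apply mopen_preimage.
    + intros z Bz. apply Hc. now exists z.
    + intros z Bz. apply Hdis. now exists z.
    + left. intros w [z [Bz ->]]. auto.
    + right. intros w [z [Bz ->]]. auto.
  - intros w [z [Bz ->]]. auto.
Qed.

Lemma chain_right A e x y : chain d A e x y -> A y.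
Proof. now intros []. Qed.

Lemma chain_left A e x y : chain d A e x y -> A x.
Proof. now induction 1. Qed.

Lemma chain_mono (A A' : T -> Prop) e e' x y : (forall z, A z -> A' z) -> e <= e' ->
  chain d A e x y -> chain d A' e' x y.
Proof.
  intros HA He. induction 1 as [|y z _ IH Az L].
  - apply chain_start. auto.
  - apply chain_step with y; auto. lra.
Qed.

Lemma chain_trans A e x y z :
  chain d A e x y -> chain d A e y z -> chain d A e x z.
Proof.
  intros H. induction 1 as [|z1 z2 _ IH Az L]; [exact H|].
  now apply chain_step with z1.
Qed.

(** A discrete boundary crossing: [b] is the last point before the chain first leaves [P], and [c]
    is the next one. *)
Lemma chain_first_exit (A P : T -> Prop) e x y : chain d A e x y -> P x ->
  chain d (fun z => A z /\ P z) e x y \/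
  exists b c, chain d (fun z => A z /\ P z) e x b /\ A c /\ ~ P c /\ d b c < e.
Proof.
  intros H Px. induction H as [Ax|y z _ IH Az L].
  - left. now apply chain_start.
  - destruct IH as [IH|IH]; [|now right].
    destruct (classic (P z)) as [Pz|Pz].
    + left. now apply chain_step with y.
    + right. now exists y, z.
Qed.

(** The points within [e] of a reachable point and those within [e] of an unreachable one form two
    open sets covering [B]. They are disjoint on [B], since a common point would extend a chain to
    an unreachable point. *)
Lemma chain_of_component (A : T -> Prop) e x y : 0 < e -> component d A x y ->
  chain d A e x y.
Proof.
  intros He [B [HB [Bx [By HA]]]].
  apply chain_mono with (A := B) (e := e); [exact HA|lra|].
  assert (Bxx : chain d B e x x) by now apply chain_start.
  destruct (HB (fun z => exists b, chain d B e x b /\ d b z < e)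
               (fun z => exists b, B b /\ ~ chain d B e x b /\ d b z < e))
    as [H|H].
  - intros z [b [Hb L]]. destruct (mopen_ball b e z L) as [r [Hr H]].
    exists r. split; [exact Hr|]. intros w Hw. exists b. auto.
  - intros z [b [Hb [Hn L]]]. destruct (mopen_ball b e z L) as [r [Hr H]].
    exists r. split; [exact Hr|]. intros w Hw. exists b. auto.
  - intros z Bz. destruct (classic (chain d B e x z)) as [C|C].
    + left. exists z. rewrite dist_refl. auto.
    + right. exists z. rewrite dist_refl. auto.
  - intros z Bz [b [Hb L]] [c [Bc [Hc L']]]. apply Hc.
    apply chain_step with z; [now apply chain_step with b|exact Bc|].
    now rewrite (dist_sym _ _ Hd).
  - destruct (H y By) as [b [Hb L]]. now apply chain_step with b.
  - exfalso. destruct (H x Bx) as [b [Bb [Hb L]]]. apply Hb.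
    apply chain_step with x; auto. now rewrite (dist_sym _ _ Hd).
Qed.

Lemma chain_closed A x p : mclosed d A ->
  (forall e, 0 < e -> exists c, d p c < e /\ chain d A e x c) ->
  forall e, 0 < e -> chain d A e x p.
Proof.
  intros HA H e He. destruct (H e He) as [c [L Hc]].
  apply chain_step with c; [exact Hc| |now rewrite (dist_sym _ _ Hd)].
  apply HA. intros r Hr. destruct (H r Hr) as [c' [L' Hc']].
  exists c'. split; [now apply chain_right in Hc'|exact L'].
Qed.

End Metric.

(** * Compact metric spaces *)

Section CompactMetric.
Context {T : Type} {d : T -> T -> R} (Hd : is_metric T d) (HX : compact_space d).

Lemma cluster_point (u : nat -> T) : exists p, forall r N, 0 < r ->
  exists n, (N <= n)%nat /\ d p (u n) < r.
Proof.
  apply NNPP. intros H.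
  set (far := fun p r N => forall n, (N <= n)%nat -> r <= d p (u n)).
  (* Cover by balls that the sequence avoids from time [N] on. The clause [far] makes the set of any
     other triple empty. *)
  destruct (HX (T * R * nat)%type (fun i z =>
    far (fst (fst i)) (snd (fst i)) (snd i) /\ d (fst (fst i)) z < snd (fst i)))
    as [l Hl].
  - intros [[p r] N] x [Hf L]. destruct (mopen_ball Hd p r x L) as [s [Hs Hsr]].
    exists s. split; [exact Hs|]. intros y Hy. split; [exact Hf|]. now apply Hsr.
  - intros p. apply NNPP. intros H'. apply H. exists p. intros r N Hr.
    apply NNPP. intros H''. apply H'. exists (p, r, N). simpl.
    rewrite (dist_refl Hd). split; [|exact Hr]. intros n Hn.
    apply Rnot_lt_le. intros L. apply H''. now exists n.
  (* The term at a time past all those in the finite subcover lies in none of its balls. *)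
  - set (M := list_max (map snd l)).
    destruct (Hl (u M)) as [[[p r] N] [Hin [Hf L]]]; simpl in Hf, L.
    assert (HM : (N <= M)%nat).
    { assert (HF := proj1 (list_max_le (map snd l) M) (le_n _)).
      rewrite Forall_forall in HF. apply HF.
      apply in_map_iff. now exists (p, r, N). }
    specialize (Hf M HM). lra.
Qed.

Lemma cluster_point2 (u v : nat -> T) : exists p q, forall r N, 0 < r ->
  exists n, (N <= n)%nat /\ d p (u n) < r /\ d q (v n) < r.
Proof.
  destruct (cluster_point u) as [p Hp].
  destruct (seq_choice (fun k n => (k <= n)%nat /\ d p (u n) < / (INR k + 1)))
    as [phi Hphi].
  { intros k. apply Hp, inv_succ_pos. }
  destruct (cluster_point (fun k => v (phi k))) as [q Hq].
  exists p, q. intros r N Hr. destruct (inv_succ_small r Hr) as [M HM].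
  destruct (Hq r (N + M)%nat Hr) as [k [Hk L]]. destruct (Hphi k) as [Hk' L'].
  exists (phi k). repeat split; [lia| |exact L].
  apply Rlt_trans with (1 := L'). apply HM. lia.
Qed.

Lemma mcompact_closed A : mclosed d A -> mcompact d A.
Proof.
  intros HA I U HU Hcov.
  destruct (HX (option I)
    (fun o z => match o with Some i => U i z | None => ~ A z end)) as [l Hl].
  - intros [i|]; [apply HU|now apply mopen_compl].
  - intros x. destruct (classic (A x)) as [Ax|Ax].
    + destruct (Hcov x Ax) as [i Hi]. now exists (Some i).
    + now exists None.
  - exists (flat_map (fun o => match o with Some i => i :: nil | None => nil end) l).
    intros x Ax. destruct (Hl x) as [[i|] [Hin Hx]]; [|contradiction].
    exists i. split; [|exact Hx]. apply in_flat_map. exists (Some i). simpl. auto.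
Qed.

Lemma mclosed_chained A x : mclosed d A -> mclosed d (chained d A x).
Proof.
  intros HA p H. refine (chain_closed Hd A x p HA _). intros e He.
  destruct (H e He) as [c [Hc L]]. exists c. auto.
Qed.

(** Otherwise pairs from the two sides, with distance tending to 0, cluster at one point of [A]. The
    open set containing it then also contains a partner from the other side. *)
Lemma separation_gap (A U V : T -> Prop) : mclosed d A -> mopen d U -> mopen d V ->
  (forall x, A x -> U x \/ V x) -> (forall x, A x -> U x -> V x -> False) ->
  exists r, 0 < r /\ forall x y, A x -> U x -> A y -> V y -> r <= d x y.
Proof.
  intros HA HU HV Hc Hdis. apply NNPP. intros H.
  destruct (seq_choice (fun n (z : T * T) =>
    A (fst z) /\ U (fst z) /\ A (snd z) /\ V (snd z) /\
    d (fst z) (snd z) < / (INR n + 1))) as [w Hw].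
  { intros n. apply NNPP. intros H'. apply H. exists (/ (INR n + 1)).
    split; [apply inv_succ_pos|]. intros x y Ax Ux Ay Vy. apply Rnot_lt_le.
    intros L. apply H'. now exists (x, y). }
  destruct (cluster_point (fun n => fst (w n))) as [p Hp].
  assert (Hnear : forall r, 0 < r -> exists n, d p (fst (w n)) < r /\ d p (snd (w n)) < r).
  { intros r Hr. destruct (inv_succ_small (r / 2)) as [N HN]; [lra|].
    destruct (Hp (r / 2) N) as [n [Hn L]]; [lra|]. specialize (HN n Hn).
    destruct (Hw n) as [_ [_ [_ [_ L']]]].
    pose proof (dist_tri _ _ Hd p (fst (w n)) (snd (w n))).
    exists n. split; lra. }
  assert (Ap : A p).
  { apply HA. intros r Hr. destruct (Hnear r Hr) as [n [L _]].
    exists (fst (w n)). split; [apply Hw|exact L]. }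
  destruct (Hc p Ap) as [Up|Vp].
  - destruct (HU p Up) as [r [Hr Hr']]. destruct (Hnear r Hr) as [n [_ L]].
    destruct (Hw n) as [? [? [? [? _]]]]. apply (Hdis (snd (w n))); auto.
  - destruct (HV p Vp) as [r [Hr Hr']]. destruct (Hnear r Hr) as [n [L _]].
    destruct (Hw n) as [? [? [? [? _]]]]. apply (Hdis (fst (w n))); auto.
Qed.

(* If [U], [V] separate the chained class of [x] with a gap, fine chains crossing
   the gap have points far from both parts; a cluster point of these is again
   chained to [x]. *)
Lemma chained_subset_side A U V x : mclosed d A -> mopen d U -> mopen d V ->
  (forall z, chained d A x z -> U z \/ V z) ->
  (forall z, chained d A x z -> U z -> V z -> False) ->
  A x -> U x -> forall y, chained d A x y -> U y.
Proof.
  intros HA HU HV Hc Hdis Ax Ux y Qy.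
  destruct (Hc y Qy) as [Uy|Vy]; [exact Uy|exfalso].
  assert (Qx : chained d A x x) by (intros e He; now apply chain_start).
  destruct (separation_gap (chained d A x) U V) as [g [Hg Hgap]]; auto.
  { now apply mclosed_chained. }
  set (nearU := fun z => exists q, chained d A x q /\ U q /\ d q z < g / 3).
  destruct (seq_choice (fun n c => chain d A (/ (INR n + 1)) x c /\ ~ nearU c /\
    (/ (INR n + 1) < g / 3 -> exists b, nearU b /\ d b c < g / 3))) as [w Hw].
  { intros n. pose proof (inv_succ_pos n) as Hn.
    destruct (chain_first_exit A nearU _ _ _ (Qy _ Hn)) as [C|[b [c [C [Ac [Nc L]]]]]].
    - exists x. rewrite (dist_refl Hd). repeat split; auto. lra.
    - exfalso. apply chain_right in C. destruct C as [_ [q [Qq [Uq L]]]].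
      specialize (Hgap q y Qq Uq Qy Vy). lra.
    - exists c. repeat split; [|exact Nc|].
      + apply chain_step with b; auto.
        apply (chain_mono (fun z => A z /\ nearU z) A (/ (INR n + 1))); [tauto|lra|auto].
      + intros L'. exists b. split; [|lra]. now apply chain_right in C. }
  destruct (cluster_point w) as [p Hp].
  assert (Qp : chained d A x p).
  { refine (chain_closed Hd A x p HA _). intros e He.
    destruct (inv_succ_small e He) as [N HN].
    destruct (Hp e N He) as [n [Hn L]]. exists (w n). split; [exact L|].
    apply (chain_mono A A (/ (INR n + 1))); auto; [|apply Hw].
    apply Rlt_le. auto. }
  destruct (inv_succ_small (g / 3)) as [N HN]; [lra|].
  destruct (Hp (g / 3) N) as [n [Hn L]]; [lra|].
  destruct (Hw n) as [_ [Nn Hb]].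
  (* If [p] were in [U], then [w n] would be in [nearU]. If it is in [V], the path [q], [b], [w n],
     [p] has three steps below [g / 3] and crosses the gap. *)
  destruct (Hc p Qp) as [Up|Vp]; [apply Nn; now exists p|].
  destruct (Hb (HN n Hn)) as [b [[q [Qq [Uq L1]]] L2]].
  specialize (Hgap q p Qq Uq Qp Vp).
  pose proof (dist_tri _ _ Hd q b p). pose proof (dist_tri _ _ Hd b (w n) p).
  rewrite (dist_sym _ _ Hd (w n) p) in *. lra.
Qed.

Lemma mconnected_chained A x : mclosed d A -> A x -> mconnected d (chained d A x).
Proof.
  intros HA Ax U V HU HV Hc Hdis.
  assert (Qx : chained d A x x) by (intros e He; now apply chain_start).
  destruct (Hc x Qx) as [Ux|Vx].
  - left. now apply (chained_subset_side A U V x).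
  - right. apply (chained_subset_side A V U x); auto.
    + intros z Hz. destruct (Hc z Hz); auto.
    + intros z Hz Vz Uz. now apply (Hdis z).
Qed.

Lemma continuum_chained A x : mclosed d A -> A x -> continuum d (chained d A x).
Proof.
  intros HA Ax. repeat split.
  - now apply mcompact_closed, mclosed_chained.
  - now apply mconnected_chained.
  - exists x. intros e He. now apply chain_start.
Qed.

Lemma component_of_chained A x y : mclosed d A -> chained d A x y -> component d A x y.
Proof.
  intros HA H. assert (Ax : A x) by exact (chain_left _ _ _ _ (H 1 Rlt_0_1)).
  exists (chained d A x). repeat split; [now apply mconnected_chained| |exact H|].
  - intros e He. now apply chain_start.
  - intros z Hz. specialize (Hz 1 Rlt_0_1). now apply chain_right in Hz.
Qed.

(** Chains from [x] to [y] of mesh tending to 0 must leave [F]. Their last points before the exit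
    cluster at [p], which is a limit of points outside [F] and so cannot lie in the open set [U]. *)
Lemma boundary_bumping A F U x y : mclosed d A -> mclosed d F -> mopen d U ->
  (forall z, U z -> F z) -> F x -> ~ F y -> component d A x y ->
  exists p, component d (fun z => A z /\ F z) x p /\ ~ U p.
Proof.
  intros HA HF HU HUF Fx Fy Hxy.
  assert (HAF := mclosed_and _ _ HA HF).
  destruct (seq_choice (fun n b => chain d (fun z => A z /\ F z) (/ (INR n + 1)) x b /\
    exists c, ~ F c /\ d b c < / (INR n + 1))) as [w Hw].
  { intros n. destruct (chain_first_exit A F _ _ _
      (chain_of_component Hd A _ x y (inv_succ_pos n) Hxy) Fx)
      as [C|[b [c [C [Ac [Nc L]]]]]].
    - now apply chain_right in C.
    - exists b. split; [exact C|]. now exists c. }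
  destruct (cluster_point w) as [p Hp]. exists p. split.
  - apply component_of_chained; [exact HAF|]. refine (chain_closed Hd _ x p HAF _).
    intros e He. destruct (inv_succ_small e He) as [N HN].
    destruct (Hp e N He) as [n [Hn L]]. exists (w n). split; [exact L|].
    eapply chain_mono; [| |apply (Hw n)]; [auto|apply Rlt_le; auto].
  - intros Up. destruct (HU p Up) as [r [Hr HrU]].
    destruct (inv_succ_small (r / 2)) as [N HN]; [lra|].
    destruct (Hp (r / 2) N) as [n [Hn L]]; [lra|]. specialize (HN n Hn).
    destruct (Hw n) as [_ [c [Nc L']]]. apply Nc, HUF, HrU.
    pose proof (dist_tri _ _ Hd p (w n) c). lra.
Qed.

(** By compactness some [A N] lies within [e / 3] of the intersection. Moving each point of an
    [e / 3]-chain in [A N] to a nearby point of the intersection gives a chain of mesh [e]. *)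
Lemma component_nested (A : nat -> T -> Prop) x y : (forall n, mclosed d (A n)) ->
  (forall m n z, (m <= n)%nat -> A n z -> A m z) ->
  (forall n, component d (A n) x y) -> component d (fun z => forall n, A n z) x y.
Proof.
  intros HA Hdec H. assert (HI := mclosed_forall A HA).
  apply component_of_chained; [exact HI|]. intros e He.
  assert (HN : exists N, forall z, A N z -> exists a, (forall n, A n a) /\ d a z < e / 3).
  { apply NNPP. intros HN.
    destruct (seq_choice (fun N z => A N z /\ forall a, (forall n, A n a) -> e / 3 <= d a z))
      as [w Hw].
    { intros N. apply NNPP. intros H'. apply HN. exists N. intros z Az.
      apply NNPP. intros H''. apply H'. exists z. split; [exact Az|].
      intros a Ha. apply Rnot_lt_le. intros L. apply H''. now exists a. }
    destruct (cluster_point w) as [p Hp].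
    destruct (Hp (e / 3) 0%nat) as [n [_ L]]; [lra|].
    destruct (Hw n) as [_ F]. enough (Hall : forall k, A k p) by (specialize (F p Hall); lra).
    intros k. apply HA. intros r Hr. destruct (Hp r k Hr) as [m [Hm L']].
    exists (w m). split; [|exact L']. apply (Hdec k m); auto. apply Hw. }
  destruct HN as [N HN].
  assert (P : forall z, chain d (A N) (e / 3) x z ->
    exists a, d a z < e / 3 /\ chain d (fun z => forall n, A n z) e x a).
  { induction 1 as [_|z1 z2 _ [a [L1 C]] Az L].
    - exists x. rewrite (dist_refl Hd). split; [lra|]. apply chain_start.
      intros n. now apply component_left with (1 := H n).
    - destruct (HN z2 Az) as [b [Hb L2]]. exists b. split; [exact L2|].
      apply chain_step with a; [exact C|exact Hb|].
      pose proof (dist_tri _ _ Hd a z1 b). pose proof (dist_tri _ _ Hd z1 z2 b).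
      rewrite (dist_sym _ _ Hd z2 b) in *. lra. }
  destruct (P y) as [a [L C]]; [apply (chain_of_component Hd); [lra|apply H]|].
  apply chain_step with a; [exact C| |lra].
  intros n. now apply component_right with (1 := H n).
Qed.

(** * Uniformity from compactness *)

Lemma uniform_continuity f : mcontinuous d f -> forall e, 0 < e ->
  exists s, 0 < s /\ forall x y, d x y < s -> d (f x) (f y) < e.
Proof.
  intros Hf e He. apply NNPP. intros H.
  destruct (seq_choice (fun n (z : T * T) =>
    d (fst z) (snd z) < / (INR n + 1) /\ e <= d (f (fst z)) (f (snd z)))) as [w Hw].
  { intros n. apply NNPP. intros H'. apply H. exists (/ (INR n + 1)).
    split; [apply inv_succ_pos|]. intros x y L. apply Rnot_le_lt. intros L'.
    apply H'. now exists (x, y). }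
  destruct (cluster_point (fun n => fst (w n))) as [p Hp].
  destruct (Hf p (e / 2)) as [s [Hs Hfs]]; [lra|].
  destruct (inv_succ_small (s / 2)) as [N HN]; [lra|].
  destruct (Hp (s / 2) N) as [n [Hn L]]; [lra|]. specialize (HN n Hn).
  destruct (Hw n) as [L1 L2].
  pose proof (dist_tri _ _ Hd p (fst (w n)) (snd (w n))).
  pose proof (Hfs (fst (w n))). pose proof (Hfs (snd (w n))).
  pose proof (dist_tri _ _ Hd (f (fst (w n))) (f p) (f (snd (w n)))).
  rewrite (dist_sym _ _ Hd (f (fst (w n))) (f p)) in *. lra.
Qed.

Lemma uniform_continuity_iter f n : mcontinuous d f -> forall e, 0 < e ->
  exists s, 0 < s /\ forall x y i, (i <= n)%nat -> d x y < s ->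
    d (Nat.iter i f x) (Nat.iter i f y) < e.
Proof.
  intros Hf e He. induction n as [|n [s [Hs IH]]].
  - exists e. split; [exact He|]. intros x y i Hi L. now replace i with 0%nat by lia.
  - destruct (uniform_continuity _ (mcontinuous_iter f (S n) Hf) e He) as [t [Ht H]].
    exists (Rmin s t). split; [now apply Rmin_glb_lt|]. intros x y i Hi L.
    pose proof (Rmin_l s t). pose proof (Rmin_r s t).
    destruct (Nat.eq_dec i (S n)) as [->|]; [apply H; lra|apply IH; [lia|lra]].
Qed.

Lemma uniform_local_connectedness : locally_connected_space d -> forall r, 0 < r ->
  exists s, 0 < s /\ forall x y, d x y < s -> component d (fun z => d x z <= r) x y.
Proof.
  intros HL r Hr. apply NNPP. intros H.
  destruct (seq_choice (fun n (z : T * T) => d (fst z) (snd z) < / (INR n + 1) /\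
    ~ component d (fun t => d (fst z) t <= r) (fst z) (snd z))) as [w Hw].
  { intros n. apply NNPP. intros H'. apply H. exists (/ (INR n + 1)).
    split; [apply inv_succ_pos|]. intros x y L. apply NNPP. intros L'.
    apply H'. now exists (x, y). }
  destruct (cluster_point (fun n => fst (w n))) as [p Hp].
  destruct (HL p (fun z => d p z < r / 2)) as [V [HV [Vp [CV VB]]]].
  { apply (mopen_ball Hd). }
  { rewrite (dist_refl Hd). lra. }
  destruct (HV p Vp) as [s [Hs HsV]].
  destruct (inv_succ_small (s / 2)) as [N HN]; [lra|].
  destruct (Hp (s / 2) N) as [n [Hn L]]; [lra|]. specialize (HN n Hn).
  destruct (Hw n) as [L1 L2]. apply L2.
  pose proof (dist_tri _ _ Hd p (fst (w n)) (snd (w n))).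
  assert (V (fst (w n))) by (apply HsV; lra).
  exists V. repeat split; [exact CV|assumption|apply HsV; lra|].
  intros z Vz. pose proof (VB _ Vz). pose proof (VB (fst (w n))).
  pose proof (dist_tri _ _ Hd (fst (w n)) p z).
  rewrite (dist_sym _ _ Hd (fst (w n)) p) in *. intuition lra.
Qed.

Lemma no_isolated_point : mconnected d (fun _ => True) -> (exists x y : T, x <> y) ->
  forall u r, 0 < r -> exists z, z <> u /\ d u z < r.
Proof.
  intros HC [a [b Hab]] u r Hr. apply NNPP. intros H.
  destruct (HC (fun z => z = u) (fun z => z <> u)) as [H'|H'].
  - intros x ->. exists r. split; [exact Hr|]. intros y L. apply NNPP.
    intros N. apply H. now exists y.
  - intros x Nx. exists (d u x). split.
    + pose proof (dist_nonneg _ _ Hd u x). destruct H0 as [|E]; [assumption|].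
      exfalso. apply Nx. symmetry. now apply (dist_eq0 _ _ Hd).
    + intros y L ->. rewrite (dist_sym _ _ Hd) in L. lra.
  - intros x _. apply classic.
  - intros x _ E N. contradiction.
  - apply Hab. rewrite (H' a I), (H' b I). reflexivity.
  - now apply (H' u I).
Qed.

Lemma finite_net r : 0 < r -> exists l : list T, forall x, exists c, In c l /\ d c x < r.
Proof.
  intros Hr. apply (HX T (fun c x => d c x < r)).
  - intros c. apply (mopen_ball Hd).
  - intros x. exists x. now rewrite (dist_refl Hd).
Qed.

End CompactMetric.

(** * Bowen balls and cw-expansivity *)

Definition bowen {T : Type} (d : T -> T -> R) (f : T -> T) (n : nat) (r : R) (x : T) :
  T -> Prop :=
  fun z => forall i, (i <= n)%nat -> d (Nat.iter i f x) (Nat.iter i f z) <= r.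

Definition bowen2 {T : Type} (d : T -> T -> R) (f g : T -> T) (n : nat) (r : R) (x : T) :
  T -> Prop :=
  fun z => bowen d f n r x z /\ bowen d g n r x z.

Lemma mclosed_bowen {T : Type} {d : T -> T -> R} (Hd : is_metric T d) f n r x :
  mcontinuous d f -> mclosed d (bowen d f n r x).
Proof.
  intros Hf. apply mclosed_forall. intros i. apply mclosed_imp.
  apply (mclosed_preimage_ball Hd (Nat.iter i f)). now apply mcontinuous_iter.
Qed.

Lemma mclosed_bowen2 {T : Type} {d : T -> T -> R} (Hd : is_metric T d) f g n r x :
  mcontinuous d f -> mcontinuous d g -> mclosed d (bowen2 d f g n r x).
Proof. intros Hf Hg. apply mclosed_and; now apply mclosed_bowen. Qed.

(** Sets within [2 * beta = alpha / 2] of a centre have diameter at most [alpha]. The factor 2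
    leaves room for radius [beta] around moving centres to become [2 * beta] around their limit. *)
Lemma cw_expansive_component {T : Type} {d : T -> T -> R} (f g : T -> T) :
  is_metric T d -> compact_space d -> mcontinuous d f -> mcontinuous d g ->
  cw_expansive d f g ->
  exists beta, 0 < beta /\ forall x y,
    component d (fun z => forall n, bowen2 d f g n (2 * beta) x z) x y -> x = y.
Proof.
  intros Hd HX Hf Hg [alpha [Ha Hexp]]. exists (alpha / 4). split; [lra|].
  intros x y Hxy. apply NNPP. intros N.
  set (A := fun z => forall n, bowen2 d f g n (2 * (alpha / 4)) x z) in *.
  assert (HA : mclosed d A) by (apply mclosed_forall; intros n; now apply mclosed_bowen2).
  assert (Ax := component_left _ _ _ Hxy).
  destruct (Hexp (chained d A x)) as [n Hn].
  { now apply continuum_chained. }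
  { exists x, y. repeat split; [| |exact N].
    - intros e He. now apply chain_start.
    - intros e He. now apply chain_of_component. }
  apply (Rbar_lt_not_le _ _ Hn). apply Lub_Rbar_correct.
  intros r [a [b [[a' [Ca ->]] [[b' [Cb ->]] ->]]]]. simpl.
  assert (Aa := chain_right _ _ _ _ (Ca 1 Rlt_0_1)).
  assert (Ab := chain_right _ _ _ _ (Cb 1 Rlt_0_1)).
  assert (Hi : forall z, A z ->
    d (iterZ f g n x) (iterZ f g n z) <= 2 * (alpha / 4)).
  { intros z Az. destruct n as [|p|p]; simpl.
    - exact (proj1 (Az 0%nat) 0%nat (le_n _)).
    - exact (proj1 (Az _) _ (le_n _)).
    - exact (proj2 (Az _) _ (le_n _)). }
  pose proof (Hi a' Aa). pose proof (Hi b' Ab).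
  pose proof (dist_tri _ _ Hd (iterZ f g n a') (iterZ f g n x) (iterZ f g n b')).
  rewrite (dist_sym _ _ Hd (iterZ f g n a') (iterZ f g n x)) in *. lra.
Qed.

(** * Contraction of continua with small orbits *)

Section Dynamics.
Context {T : Type} {d : T -> T -> R} (Hd : is_metric T d) (HX : compact_space d).
Context (f g : T -> T) (Hf : mcontinuous d f) (Hg : mcontinuous d g).
Context (Hgf : forall x, g (f x) = x) (Hfg : forall x, f (g x) = x).
Context (beta : R) (Hbeta : 0 < beta).
Context (Hexp : forall x y,
  component d (fun z => forall n, bowen2 d f g n (2 * beta) x z) x y -> x = y).

(** Counterexamples for all [N] cluster at a pair [p], [q] of distinct points. For each [n], the
    components pass to the limit inside the [2 * beta] Bowen ball of [p], so [q] contradicts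
    [Hexp]. *)
Lemma uniform_expansivity eta : 0 < eta -> exists N, forall x y,
  component d (bowen2 d f g N beta x) x y -> d x y <= eta.
Proof.
  intros He. apply NNPP. intros H.
  destruct (seq_choice (fun N (z : T * T) =>
    component d (bowen2 d f g N beta (fst z)) (fst z) (snd z) /\ eta < d (fst z) (snd z)))
    as [w Hw].
  { intros N. apply NNPP. intros H'. apply H. exists N. intros x y Hxy.
    apply Rnot_lt_le. intros L. apply H'. now exists (x, y). }
  destruct (cluster_point2 Hd HX (fun n => fst (w n)) (fun n => snd (w n)))
    as [p [q Hpq]].
  assert (Npq : p <> q).
  { intros <-. destruct (Hpq (eta / 2) 0%nat) as [n [_ [L1 L2]]]; [lra|].
    destruct (Hw n) as [_ L]. pose proof (dist_tri _ _ Hd (fst (w n)) p (snd (w n))).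
    rewrite (dist_sym _ _ Hd (fst (w n)) p) in *. lra. }
  apply Npq, Hexp. apply (component_nested Hd HX).
  { intros n. now apply mclosed_bowen2. }
  { intros m n z Hmn [H1 H2]. split; intros i Hi; [apply H1|apply H2]; lia. }
  intros n. assert (HA := mclosed_bowen2 Hd f g n (2 * beta) p Hf Hg).
  apply (component_of_chained Hd HX); [exact HA|].
  refine (chain_closed Hd _ _ _ HA _). intros e Hepos.
  destruct (uniform_continuity_iter Hd HX f n Hf beta Hbeta) as [s1 [Hs1 H1]].
  destruct (uniform_continuity_iter Hd HX g n Hg beta Hbeta) as [s2 [Hs2 H2]].
  destruct (Hpq (Rmin e (Rmin s1 s2)) n) as [N [HN [L1 L2]]].
  { repeat apply Rmin_glb_lt; assumption. }
  pose proof (Rmin_l e (Rmin s1 s2)). pose proof (Rmin_r e (Rmin s1 s2)).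
  pose proof (Rmin_l s1 s2). pose proof (Rmin_r s1 s2).
  destruct (Hw N) as [C _].
  assert (Hsub : forall z, bowen2 d f g N beta (fst (w N)) z ->
    bowen2 d f g n (2 * beta) p z).
  { intros z [Z1 Z2]. split; intros i Hi.
    - specialize (H1 p (fst (w N)) i Hi). specialize (Z1 i).
      pose proof (dist_tri _ _ Hd (Nat.iter i f p) (Nat.iter i f (fst (w N))) (Nat.iter i f z)).
      assert (i <= N)%nat by lia. intuition lra.
    - specialize (H2 p (fst (w N)) i Hi). specialize (Z2 i).
      pose proof (dist_tri _ _ Hd (Nat.iter i g p) (Nat.iter i g (fst (w N))) (Nat.iter i g z)).
      assert (i <= N)%nat by lia. intuition lra. }
  exists (snd (w N)). split; [lra|]. apply chain_trans with (fst (w N)).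
  - apply chain_step with p; [apply chain_start| |lra].
    + split; intros i _; rewrite (dist_refl Hd); lra.
    + apply Hsub, (component_left _ _ _ C).
  - apply (chain_mono (bowen2 d f g N beta (fst (w N))) _ e); [exact Hsub|lra|].
    now apply chain_of_component.
Qed.

(** Seen from time [i], the times from 0 to [n] contain [N] steps in both directions, so uniform
    expansivity applies to the [i]-th image. *)
Lemma bowen_contraction eta : 0 < eta -> exists N, forall x y n i,
  component d (bowen d f n beta x) x y -> (N <= i)%nat -> (i + N <= n)%nat ->
  d (Nat.iter i f x) (Nat.iter i f y) <= eta.
Proof.
  intros He. destruct (uniform_expansivity eta He) as [N HN]. exists N.
  intros x y n i C Hi Hn. apply HN.
  apply (component_image (Nat.iter i f) (bowen d f n beta x)).
  { now apply mcontinuous_iter. }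
  { exact C. }
  intros z Hz. split; intros j Hj.
  - rewrite !iter_iter. apply Hz. lia.
  - rewrite !(iter_sub g f) by (assumption || lia). apply Hz. lia.
Qed.

Lemma stable_contraction eta : 0 < eta -> exists N, forall x y i,
  component d (Ws d f beta x) x y -> (N <= i)%nat ->
  d (Nat.iter i f x) (Nat.iter i f y) <= eta.
Proof.
  intros He. destruct (bowen_contraction eta He) as [N HN]. exists N.
  intros x y i C Hi. apply (HN x y (i + N)%nat); auto.
  apply component_sub with (1 := C). intros z Hz j _.
  now apply component_right in Hz.
Qed.

Lemma mopen_bowen_interior n r x :
  mopen d (fun z => forall i, (i <= n)%nat -> d (Nat.iter i f x) (Nat.iter i f z) < r).
Proof.
  apply mopen_forall_le. intros i.
  apply (mopen_preimage (Nat.iter i f) (fun z => d (Nat.iter i f x) z < r)).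
  - now apply mcontinuous_iter.
  - apply (mopen_ball Hd).
Qed.

(** Bumping between the strict and the weak Bowen inequalities: the cut piece attains size [r]
    exactly. *)
Lemma bowen_bumping A n r x y : mclosed d A -> component d A x y ->
  0 < r -> ~ bowen d f n r x y ->
  exists p, component d (fun z => A z /\ bowen d f n r x z) x p /\
    exists i, (i <= n)%nat /\ r <= d (Nat.iter i f x) (Nat.iter i f p).
Proof.
  intros HA C Hr Ny.
  destruct (boundary_bumping Hd HX A (bowen d f n r x) _ x y HA
    (mclosed_bowen Hd f n r x Hf) (mopen_bowen_interior n r x)) as [p [Cp Hp]]; auto.
  { intros z Hz i Hi. apply Rlt_le. auto. }
  { intros i _. rewrite (dist_refl Hd). lra. }
  exists p. split; [exact Cp|]. apply NNPP. intros H. apply Hp. intros i Hi.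
  apply Rnot_le_lt. intros L. apply H. now exists i.
Qed.

(** Kato's lemma. If the bound failed, a bumped piece would attain size [eps] at some time [i]
    without exceeding it. Contraction to [eps / 2] excludes [i] at distance at least [N] from both
    ends; uniform continuity of the iterates of [f] and [g] excludes [i] near the start and the
    end. *)
Lemma small_ends_small_orbit eps : 0 < eps <= beta -> exists del, 0 < del /\
  forall n x y,
    component d (fun z => d x z <= del /\ d (Nat.iter n f x) (Nat.iter n f z) <= del) x y ->
    bowen d f n eps x y.
Proof.
  intros He. destruct (bowen_contraction (eps / 2)) as [N HN]; [lra|].
  destruct (uniform_continuity_iter Hd HX f N Hf eps) as [s1 [Hs1 H1]]; [lra|].
  destruct (uniform_continuity_iter Hd HX g N Hg eps) as [s2 [Hs2 H2]]; [lra|].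
  pose proof (Rmin_l s1 s2). pose proof (Rmin_r s1 s2).
  assert (0 < Rmin s1 s2) by now apply Rmin_glb_lt.
  exists (Rmin s1 s2 / 2). split; [lra|]. intros n x y C. apply NNPP. intros Ny.
  assert (HA : mclosed d (fun z => d x z <= Rmin s1 s2 / 2 /\
    d (Nat.iter n f x) (Nat.iter n f z) <= Rmin s1 s2 / 2)).
  { apply mclosed_and; [apply (mclosed_ball Hd)|].
    apply (mclosed_preimage_ball Hd (Nat.iter n f)). now apply mcontinuous_iter. }
  destruct (bowen_bumping _ n eps x y HA C (proj1 He) Ny) as [p [Cp [i [Hi L]]]].
  destruct (component_right _ _ _ Cp) as [[D1 D2] _].
  assert (Cb : component d (bowen d f n beta x) x p).
  { apply component_sub with (1 := Cp). intros z Hz j Hj.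
    apply component_right in Hz. destruct Hz as [_ Hz]. specialize (Hz j Hj). lra. }
  destruct (Nat.le_gt_cases N i) as [Hi1|Hi1].
  - destruct (Nat.le_gt_cases (i + N) n) as [Hi2|Hi2].
    + specialize (HN x p n i Cb Hi1 Hi2). lra.
    + specialize (H2 (Nat.iter n f x) (Nat.iter n f p) (n - i)%nat).
      rewrite !(iter_sub g f) in H2 by (assumption || lia).
      replace (n - (n - i))%nat with i in H2 by lia.
      assert (n - i <= N)%nat by lia. intuition lra.
  - specialize (H1 x p i). assert (i <= N)%nat by lia. intuition lra.
Qed.

(* The points of the backward orbit of a stable ball have neighbourhoods of uniform
   size that contract forward: a continuum [K] of diameter at most [del] at [g^n z]
   whose [n]-th image left the ball could, by bumping, be cut so as to reach
   exactly its boundary, but the cut piece contracts. *)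
Lemma backward_stable_size eps0 : 2 * eps0 <= beta -> exists del, 0 < del /\
  forall u rho, 0 < rho ->
  (forall y, d u y <= rho -> forall i, d (Nat.iter i f u) (Nat.iter i f y) <= eps0) ->
  exists N, forall n z w, (N <= n)%nat -> d u z < rho / 2 ->
    component d (fun t => d (Nat.iter n g z) t <= del) (Nat.iter n g z) w ->
    component d (Ws d f beta (Nat.iter n g z)) (Nat.iter n g z) w.
Proof.
  intros He0. destruct (small_ends_small_orbit beta) as [del [Hdel Hk]]; [lra|].
  exists del. split; [exact Hdel|]. intros u rho Hrho Hst.
  destruct (stable_contraction del Hdel) as [N1 HN1].
  destruct (stable_contraction (rho / 4)) as [N0 HN0]; [lra|].
  exists N0. intros n z w Hn Hz Cw.
  assert (Hz' : d u z <= rho) by lra.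
  set (zn := Nat.iter n g z) in *.
  assert (Ezn : Nat.iter n f zn = z) by now apply iter_cancel.
  set (D := fun t => d zn t <= del).
  set (F := fun t => d u (Nat.iter n f t) <= rho).
  assert (HF : mclosed d F).
  { apply (mclosed_preimage_ball Hd (Nat.iter n f)). now apply mcontinuous_iter. }
  assert (HDF : forall y, component d (fun t => D t /\ F t) zn y ->
    component d (Ws d f beta zn) zn y).
  { intros y Cy. apply component_sub with (1 := Cy). clear y Cy. intros y Cy i.
    (* Kato's lemma with a horizon beyond [i]: at time [n] the piece lies in the stable ball, and
       [N1 + i] steps later it has contracted to size [del]. *)
    apply (Hk (N1 + i + n)%nat); [|lia].
    apply component_sub with (1 := Cy). clear y Cy. intros y Cy.
    split; [now apply component_right in Cy|].
    rewrite <- !(iter_iter f (N1 + i) n), Ezn. apply HN1; [|lia].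
    rewrite <- Ezn at 2.
    apply (component_image (Nat.iter n f) (fun t => D t /\ F t)).
    { now apply mcontinuous_iter. }
    { exact Cy. }
    intros t [_ Ft] j. pose proof (Hst z Hz' j). pose proof (Hst _ Ft j).
    pose proof (dist_tri _ _ Hd (Nat.iter j f z) (Nat.iter j f u)
      (Nat.iter j f (Nat.iter n f t))).
    rewrite (dist_sym _ _ Hd (Nat.iter j f z) (Nat.iter j f u)) in *. lra. }
  apply HDF. apply component_sub with (1 := Cw). clear w Cw. intros w Cw.
  split; [now apply component_right in Cw|]. apply NNPP. intros NF.
  destruct (boundary_bumping Hd HX D F (fun t => d u (Nat.iter n f t) < rho) zn w)
    as [p [Cp Np]]; auto.
  - apply (mclosed_ball Hd).
  - apply (mopen_preimage (Nat.iter n f) (fun t => d u t < rho)).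
    + now apply mcontinuous_iter.
    + apply (mopen_ball Hd).
  - intros t Ht. now apply Rlt_le.
  - unfold F. rewrite Ezn. lra.
  (* At time [n] the piece reaches from [z], within [rho / 2] of [u], less than [rho / 4] further,
     so it misses the boundary of the ball. *)
  - apply Np. specialize (HN0 _ _ n (HDF p Cp) Hn). rewrite Ezn in HN0.
    pose proof (dist_tri _ _ Hd u z (Nat.iter n f p)). lra.
Qed.

(** * Absence of stable points *)

Lemma stable_ball_periodic eps0 u rho : locally_connected_space d ->
  2 * eps0 <= beta -> 0 < rho ->
  (forall y, d u y <= rho -> forall i, d (Nat.iter i f u) (Nat.iter i f y) <= eps0) ->
  forall z, d u z < rho / 2 -> exists j, (1 <= j)%nat /\ Nat.iter j f z = z.
Proof.
  intros HL He0 Hrho Hst z Hz.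
  destruct (backward_stable_size eps0 He0) as [del [Hdel HB]].
  destruct (HB u rho Hrho Hst) as [N0 HN0].
  destruct (uniform_local_connectedness Hd HX HL del Hdel) as [s [Hs Hulc]].
  destruct (finite_net Hd HX (s / 2)) as [l Hl]; [lra|].
  destruct (seq_choice (fun n c => In c l /\ d c (Nat.iter n g z) < s / 2)) as [c Hc].
  { intros n. apply Hl. }
  apply NNPP. intros H.
  (* If [z] is not periodic, its first [length l] backward iterates keep a distance [eta] from
     it. *)
  destruct (finite_lower_bound (fun j => d z (Nat.iter j g z)) (length l))
    as [eta [Heta Hlow]].
  { intros j Hj. destruct (dist_nonneg _ _ Hd z (Nat.iter j g z)) as [L|E]; [exact L|].
    exfalso. apply H. exists j. split; [lia|]. symmetry in E.
    apply (dist_eq0 _ _ Hd) in E. rewrite E at 1. now apply iter_cancel. }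
  destruct (stable_contraction (eta / 2)) as [N HN]; [lra|].
  destruct (pigeonhole_nat l c (fun n => proj1 (Hc n)) (N0 + N)%nat)
    as [a [b [Ha [Hb E]]]].
  assert (L : d (Nat.iter a g z) (Nat.iter b g z) < s).
  { destruct (Hc a) as [_ La]. destruct (Hc b) as [_ Lb]. rewrite <- E in Lb.
    pose proof (dist_tri _ _ Hd (Nat.iter a g z) (c a) (Nat.iter b g z)).
    rewrite (dist_sym _ _ Hd (Nat.iter a g z) (c a)) in *. lra. }
  (* Here [a >= N0] provides the contracting neighbourhood and [a >= N] the contraction. Applying
     [f] [a] times sends the two points to [z] and its backward iterate of order [b - a]. *)
  specialize (HN _ _ a (HN0 a z _ ltac:(lia) Hz (Hulc _ _ L)) ltac:(lia)).
  rewrite (iter_cancel f g), (iter_sub f g) in HN by (assumption || lia).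
  specialize (Hlow (b - a)%nat ltac:(lia)). simpl in Hlow. lra.
Qed.

Lemma no_stable_point eps0 u rho : locally_connected_space d ->
  mconnected d (fun _ => True) -> (exists x y : T, x <> y) ->
  2 * eps0 <= beta -> 0 < eps0 -> 0 < rho ->
  exists y, d u y <= rho /\ exists i, eps0 < d (Nat.iter i f u) (Nat.iter i f y).
Proof.
  intros HL HC Hne He0 He0' Hrho. apply NNPP. intros H.
  assert (Hst : forall y, d u y <= rho ->
    forall i, d (Nat.iter i f u) (Nat.iter i f y) <= eps0).
  { intros y Hy i. apply Rnot_lt_le. intros L. apply H. exists y.
    split; [exact Hy|]. now exists i. }
  destruct (uniform_local_connectedness Hd HX HL rho Hrho) as [s [Hs Hulc]].
  destruct (no_isolated_point Hd HC Hne u (Rmin s (rho / 2))) as [z [Nz Lz]].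
  { apply Rmin_glb_lt; lra. }
  pose proof (Rmin_l s (rho / 2)). pose proof (Rmin_r s (rho / 2)).
  assert (per := stable_ball_periodic eps0 u rho HL He0 Hrho Hst).
  destruct (per u) as [j [Hj Ej]]; [rewrite (dist_refl Hd); lra|].
  destruct (per z) as [k [Hk Ek]]; [lra|].
  assert (Hpos : 0 < d u z).
  { destruct (dist_nonneg _ _ Hd u z) as [L|E]; [exact L|].
    exfalso. apply Nz. symmetry. now apply (dist_eq0 _ _ Hd). }
  destruct (stable_contraction (d u z / 2)) as [N HN]; [lra|].
  (* At this common multiple of both periods, which is at least [N], both points have returned
     although their distance should have halved. *)
  specialize (HN u z (N * k * j)%nat).
  rewrite (iter_fixed_mul f j (N * k) u Ej) in HN.
  replace (N * k * j)%nat with (N * j * k)%nat in HN by lia.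
  rewrite (iter_fixed_mul f k (N * j) z Ek) in HN.
  assert (Hjk : (1 <= j * k)%nat) by nia.
  enough (d u z <= d u z / 2) by lra. apply HN; [|nia].
  assert (Lzs : d u z < s) by lra.
  apply component_sub with (1 := Hulc u z Lzs).
  intros t Ht i. apply component_right in Ht. specialize (Hst t Ht i). lra.
Qed.

(** Points [w N] that are stable up to time [N] cluster at some [p]. A point [y] near [p] that
    separates from it at time [i] also separates from a close [w N] with [N >= i]. *)
Lemma uniform_instability eps0 rho : locally_connected_space d ->
  mconnected d (fun _ => True) -> (exists x y : T, x <> y) ->
  2 * eps0 <= beta -> 0 < eps0 -> 0 < rho ->
  exists N, forall x, exists y, d x y < rho /\
    exists i, (i <= N)%nat /\ eps0 < d (Nat.iter i f x) (Nat.iter i f y).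
Proof.
  intros HL HC Hne He0 He0' Hrho. apply NNPP. intros H.
  destruct (seq_choice (fun N x => forall y, d x y < rho -> bowen d f N eps0 x y))
    as [w Hw].
  { intros N. apply NNPP. intros H'. apply H. exists N. intros x.
    apply NNPP. intros H''. apply H'. exists x. intros y Hy i Hi.
    apply Rnot_lt_le. intros L. apply H''. exists y. split; [exact Hy|]. now exists i. }
  destruct (cluster_point Hd HX w) as [p Hp].
  destruct (no_stable_point eps0 p (rho / 2)) as [y [Ly [i Li]]]; auto; [lra|].
  destruct (mcontinuous_iter f i Hf p
    (d (Nat.iter i f p) (Nat.iter i f y) - eps0)) as [s [Hs Hc]]; [lra|].
  destruct (Hp (Rmin s (rho / 2)) i) as [N [HN L]]; [apply Rmin_glb_lt; lra|].
  pose proof (Rmin_l s (rho / 2)). pose proof (Rmin_r s (rho / 2)).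
  specialize (Hc (w N) ltac:(lra)).
  pose proof (dist_tri _ _ Hd (w N) p y). rewrite (dist_sym _ _ Hd (w N) p) in *.
  specialize (Hw N y ltac:(lra) i HN).
  pose proof (dist_tri _ _ Hd (Nat.iter i f p) (Nat.iter i f (w N)) (Nat.iter i f y)).
  lra.
Qed.

(** * Unstable continua of uniform size *)

Lemma unstable_continua_size eps : locally_connected_space d ->
  mconnected d (fun _ => True) -> (exists x y : T, x <> y) ->
  0 < eps -> 2 * eps <= beta ->
  exists del, 0 < del /\ forall x, exists p, component d (Wu d g eps x) x p /\ del <= d x p.
Proof.
  intros HL HC Hne He Heb.
  destruct (small_ends_small_orbit (eps / 2)) as [del [Hdel Hk]]; [lra|].
  exists del. split; [exact Hdel|]. intros x.
  destruct (uniform_local_connectedness Hd HX HL del Hdel) as [s [Hs Hulc]].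
  destruct (uniform_instability eps s) as [N HN]; auto.
  destruct (seq_choice (fun k p => component d (bowen d g k eps x) x p /\ del < d x p))
    as [w Hw].
  (* Time [n] is at least [N], so that instability shows before it, and at least [k], so that [k]
     backward iterates are controlled. *)
  { intros k. set (n := (N + k)%nat). set (y0 := Nat.iter n g x).
    assert (Ey : Nat.iter n f y0 = x) by now apply iter_cancel.
    destruct (HN y0) as [y [Ly [i [Hi Li]]]].
    destruct (bowen_bumping (fun z => d y0 z <= del) n eps y0 y)
      as [p [Cp [j [Hj Lj]]]]; auto.
    { apply (mclosed_ball Hd). }
    { intros B. specialize (B i ltac:(lia)). lra. }
    assert (Hq : exists q,
      component d (fun z => d y0 z <= del /\ bowen d f n eps y0 z) y0 q /\
      del < d (Nat.iter n f y0) (Nat.iter n f q)).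
    (* If the piece had size at most [del] at time [n] as well, Kato's lemma would keep it below
       [eps / 2], but it attains [eps] at time [j]. *)
    { apply NNPP. intros Nq. enough (B : bowen d f n (eps / 2) y0 p).
      { specialize (B j Hj). lra. }
      apply Hk. apply component_sub with (1 := Cp). intros z Cz.
      split; [now apply component_right in Cz|]. apply Rnot_lt_le. intros L.
      apply Nq. now exists z. }
    destruct Hq as [q [Cq Lq]]. exists (Nat.iter n f q). rewrite Ey in Lq.
    split; [|exact Lq]. rewrite <- Ey at 2.
    apply (component_image (Nat.iter n f)) with (2 := Cq).
    { now apply mcontinuous_iter. }
    intros z [_ Bz] m Hm. unfold n in *. rewrite <- Ey.
    rewrite !(iter_sub g f) by (assumption || lia). apply Bz. lia. }
  destruct (cluster_point Hd HX w) as [p Hp]. exists p. split.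
  - assert (C : component d (fun z => forall k, bowen d g k eps x z) x p).
    { apply (component_nested Hd HX).
      { intros k. now apply mclosed_bowen. }
      { intros m n z Hmn B i Hi. apply B. lia. }
      intros k. assert (HA := mclosed_bowen Hd g k eps x Hg).
      apply (component_of_chained Hd HX); [exact HA|].
      refine (chain_closed Hd _ _ _ HA _). intros e Hepos.
      (* For [n >= k] the point [w n] is joined to [x] inside the Bowen ball of order [k], and these
         points cluster at [p]. *)
      destruct (Hp e k Hepos) as [n [Hn L]]. exists (w n). split; [exact L|].
      apply (chain_mono (bowen d g n eps x) _ e); [|lra|].
      - intros z B i Hi. apply B. lia.
      - apply (chain_of_component Hd); [exact Hepos|apply Hw]. }
    apply component_sub with (1 := C). intros z Cz n.
    apply component_right in Cz. exact (Cz n n (le_n _)).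
  - apply Rnot_lt_le. intros L.
    destruct (Hp (del - d x p) 0%nat) as [n [_ Ln]]; [lra|].
    destruct (Hw n) as [_ Hn]. pose proof (dist_tri _ _ Hd x p (w n)). lra.
Qed.

End Dynamics.

(** * Lower bounds for the diameters *)

Lemma inf_diam_CWu_ge {T : Type} (d : T -> T -> R) (f g : T -> T) (beta : R) :
  peano_continuum d -> homeomorphism d f g -> 0 < beta ->
  (forall x y, component d (fun z => forall n, bowen2 d f g n (2 * beta) x z) x y ->
    x = y) ->
  forall eps, 0 < eps -> exists del, 0 < del /\ inf_diam_ge d (CWu d g eps) del.
Proof.
  intros [Hd [HX [HC [HL Hne]]]] [Hf [Hg [Hgf Hfg]]] Hb Hexp eps He.
  pose proof (Rmin_l eps (beta / 2)). pose proof (Rmin_r eps (beta / 2)).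
  (* Truncating [eps] at [beta / 2] only shrinks the unstable sets, so the lower bound carries
     over. *)
  destruct (unstable_continua_size Hd HX f g Hf Hg Hgf Hfg beta Hb Hexp
    (Rmin eps (beta / 2)) HL HC Hne) as [del [Hdel H']].
  - apply Rmin_glb_lt; lra.
  - lra.
  - exists del. split; [exact Hdel|]. intros x. destruct (H' x) as [p [Cp L]].
    apply Rbar_le_trans with (Finite (d x p)); [exact L|].
    apply Lub_Rbar_correct. exists x, p.
    assert (C : CWu d g eps x p).
    { apply component_sub with (1 := Cp). intros z Cz n.
      apply component_right in Cz. specialize (Cz n). lra. }
    repeat split; [|exact C]. apply component_refl. now apply component_left in C.
Qed.

Theorem theorem1 (T : Type) (d : T -> T -> R) (f g : T -> T) :
  peano_continuum d -> homeomorphism d f g -> cw_expansive d f g ->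
  forall eps, 0 < eps -> exists del, 0 < del /\
    inf_diam_ge d (CWs d f eps) del /\
    inf_diam_ge d (CWu d g eps) del.
Proof.
  intros HP HH HE eps He.
  destruct (cw_expansive_component f g (proj1 HP) (proj1 (proj2 HP))
    (proj1 HH) (proj1 (proj2 HH)) HE) as [beta [Hb Hexp]].
  destruct (inf_diam_CWu_ge d f g beta HP HH Hb Hexp eps He) as [d1 [Hd1 H1]].
  (* The stable case: [CWs d f] and [CWu d f] unfold to the same sets, and two-sided Bowen balls are
     symmetric in [f] and [g]. *)
  destruct (inf_diam_CWu_ge d g f beta HP) with (eps := eps) as [d2 [Hd2 H2]]; auto.
  { destruct HH as [? [? [? ?]]]. repeat split; assumption. }
  { intros x y C. apply Hexp. apply component_sub with (1 := C). intros z Cz n.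
    apply component_right in Cz. destruct (Cz n). now split. }
  exists (Rmin d1 d2). split; [now apply Rmin_glb_lt|].
  split; intros x; eapply Rbar_le_trans; [|apply H2| |apply H1];
    [apply Rmin_r|apply Rmin_l].
Qed.
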